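(* Assume all hypersurfaces $D_i$ ($i=1,\dots,r$) of $X$ are nonsingular, and $D_i$ has class $a_iL$, with $a_i>0$ integers and $\sum_i a_i=12$; assume the hypersurface $Z$ of $B$ is also nonsingular, and has class $aL$. Then the relation $$2m\, c(Z)=\sum_{i=1}^r\rho_*(c(D_i))$$ is universally satisfied only in the following three cases: - $(m,a)=(3,4)$ and $(a_1,a_2,\dots)=(1,1,1,1,4,4)$; - $(m,a)=(4,3)$ and $(a_1,a_2,\dots)=(1,1,1,1,1,1,3,3)$; - $(m,a)=(6,2)$ and $(a_1,a_2,\dots)=(1,\dots,1)$. In fact, the weaker requirement that the Euler characteristic relation $$2\chi(Y)=4\chi(O)+\sum_{i>4}\chi(D_i)$$ is universally satisfied for $\dim B=3$ suffices to draw the same conclusion.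
   Context: $B$ is a nonsingular compact complex variety with a line bundle $\mathscr L$, and $L=c_1(\mathscr L)$. $h$ is a general section of $\mathscr L^2$, and $\rho:X\to B$ is the double cover of $B$ ramified along $h=0$, with equation $\xi^2=h$ in the total space of $\mathscr L$; $O\subset X$ is the ramification locus $\xi=0$, of class $L$ (we also write $L$ for $\rho^*L$). The $D_i$ form a configuration (unordered, not necessarily distinct) of hypersurfaces of $X$. For nonsingular $V$, $c(V)=c(TV)\cap[V]$, and $\chi$ is the topological Euler characteristic. Origin of the relations. Let $\varphi:Y\to B$ be a nonsingular elliptic fibration of one of these types: $E_8$, with equation $y^2=x^3+fxz^4+gz^6$ in the weighted projective bundle $\mathbb P_{123}(\mathscr O\oplus\mathscr L^2\oplus\mathscr L^3)$; $E_7$, with equation $y^2=x^4+ex^2z^2+fxz^3+gz^4$ in $\mathbb P_{112}(\mathscr O\oplus\mathscr L\oplus\mathscr L^2)$; $E_6$, with equation $x^3+y^3=dxyz+exz^2+fyz^2+gz^3$ in $\mathbb P(\mathscr O\oplus\mathscr L\oplus\mathscr L)$; here $d,e,f,g$ are sections of the powers of $\mathscr L$ that make the equations homogeneous. Then $\varphi_*c(Y)=m\,c(Z)$ for $Z$ a nonsingular hypersurface of $B$ in the class $aL$ of $g=0$, with $(m,a)=(2,6),(3,4),(4,3)$ for $E_8,E_7,E_6$ respectively. Thus $2m\,c(Z)=\sum_i\rho_*c(D_i)$ is a rewriting of $2\varphi_*c(Y)=\sum_i\rho_*c(D_i)$. Typically $D_1=D_2=D_3=D_4=O$ (this is not imposed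 as a necessary condition), and then taking degrees in the latter relation gives $2\chi(Y)=4\chi(O)+\sum_{i>4}\chi(D_i)$. ''Universally satisfied'' means that the corresponding identity, depending on $m$, $a$, $a_i$, is satisfied as a formal identity in $L$ and the Chern classes $c_1(B),c_2(B),\dots$ of the base, independently of the choice of $L$ or $B$. (By adjunction and the projection formula, $c(Z)=\frac{aL}{1+aL}c(B)$ and $\rho_*c(D_i)=2\,\frac{a_iL}{1+a_iL}\cdot\frac{1+L}{1+2L}\,c(B)$.) Likewise, the Euler characteristic relation is universally satisfied for $\dim B=3$ if it holds as a formal identity of Euler characteristics computed as functions of $L$ and the Chern classes of $B$.
   Formalization: The displayed relation 2χ(Y)=4χ(O)+Σ_{i>4}χ(D_i) is treated assuming a_1=…=a_4=1 (else (m,a)=(5,2), a_i=(2,2,1,…,1) is a counterexample); for arbitrary configurations the conclusion is proved from 2χ(Y)=Σ_iχ(D_i). *)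

(* Defs.v *)
From HB Require Import structures.
From mathcomp Require Import all_boot all_order all_algebra.
From mathcomp Require Import mpoly.

Set Implicit Arguments.
Unset Strict Implicit.
Unset Printing Implicit Defensive.

Import Order.TTheory GRing.Theory Num.Theory.
Local Open Scope ring_scope.

(* Formal classes on a base B of dimension n.  The coefficients are integer
   polynomials in the formal variables L = 'X_0 and c_i(B) = 'X_i, 1 <= i <= n,
   and the outer variable 'X marks the codimension: the coefficient of 'X^k is
   the part in codimension k.  Since there is nothing in codimension > n,
   classes are compared modulo 'X^n.+1. *)
Definition fclass (n : nat) := {poly {mpoly int[n.+1]}}.

Definition feq (n : nat) (p q : fclass n) : Prop :=
  take_poly n.+1 p = take_poly n.+1 q.

Definition Lcl (n : nat) : fclass n := ('X_ord0 : {mpoly int[n.+1]}) *: 'X.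

Definition cB (n : nat) : fclass n :=
  1 + \sum_(i < n.+1 | (0 < i)%N) ('X_i : {mpoly int[n.+1]}) *: 'X^i.

(* 1 / (1 + u), for u of positive codimension. *)
Definition finv1D (n : nat) (u : fclass n) : fclass n :=
  \sum_(j < n.+1) (- u) ^+ j.

Lemma finv1DP (n : nat) (u : fclass n) :
  u`_0 = 0 -> feq ((1 + u) * finv1D u) 1.
Proof.
move=> u0; have {u0}[v ->] : exists v, u = v * 'X.
  exists (drop_poly 1 u); apply/polyP => -[|i].
    by rewrite u0 coefMX.
  by rewrite coefMX coef_drop_poly addn1.
rewrite /feq /finv1D; set w := v * 'X.
have -> : (1 + w) * (\sum_(j < n.+1) (- w) ^+ j)
          = 1 - (- v) ^+ n.+1 * 'X^(n.+1).
  have -> : 1 + w = - (- w - 1) by rewrite opprB opprK.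
  by rewrite mulNr -subrX1 opprB -exprMn mulNr.
by rewrite -mulNr take_polyD take_polyMXn_0 addr0.
Qed.

(* The push-forward to V of c(D), for D a nonsingular hypersurface of class dL
   in V and cV = c(V): by adjunction it is [D] / (1 + [D]) . c(V). *)
Definition c_hyp (n : nat) (d : int) (cV : fclass n) : fclass n :=
  (d%:~R * Lcl n) * finv1D (d%:~R * Lcl n) * cV.

Definition cZ (n : nat) (a : int) : fclass n := c_hyp a (cB n).

(* The class of B whose pull-back by rho is c(X): X is a nonsingular
   hypersurface of class 2L in the total space of the line bundle, whose
   tangent bundle has Chern class (1 + L) c(B). *)
Definition cX (n : nat) : fclass n :=
  (1 + Lcl n) * finv1D (2%:R * Lcl n) * cB n.

(* The push-forward by rho of the pull-back of p; rho has degree 2. *)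
Definition rho_push (n : nat) (p : fclass n) : fclass n := 2%:R * p.

(* rho_* c(D), for D a nonsingular hypersurface of X of class dL. *)
Definition rho_cD (n : nat) (d : int) : fclass n := rho_push (c_hyp d (cX n)).

(* 2m c(Z) = \sum_i rho_* c(D_i), for bases of every dimension; s lists the
   integers a_i. *)
Definition chern_relation (m a : int) (s : seq int) : Prop :=
  forall n : nat,
    feq (2%:R * m%:~R * cZ n a) (\sum_(d <- s) rho_cD n d).

(* The degree of a class: the integral over B of its part in codimension n,
   as a polynomial in L and the Chern classes of B. *)
Definition fdeg (n : nat) (p : fclass n) : {mpoly int[n.+1]} := p`_n.

(* phi_* c(Y) = m c(Z). *)
Definition chiY (n : nat) (m a : int) : {mpoly int[n.+1]} :=
  fdeg (m%:~R * cZ n a).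

Definition chiD (n : nat) (d : int) : {mpoly int[n.+1]} := fdeg (rho_cD n d).

(* The ramification locus O has class L in X. *)
Definition chiO (n : nat) : {mpoly int[n.+1]} := chiD n 1.

(* 2 chi(Y) = 4 chi(O) + \sum_(i > 4) chi(D_i) for dim B = 3, to be used when
   D_1 = D_2 = D_3 = D_4 = O. *)
Definition euler_relation_4O (m a : int) (s : seq int) : Prop :=
  2%:R * chiY 3 m a = 4%:R * chiO 3 + \sum_(d <- drop 4 s) chiD 3 d.

(* 2 chi(Y) = \sum_i chi(D_i) for dim B = 3, with no condition on the D_i. *)
Definition euler_relation (m a : int) (s : seq int) : Prop :=
  2%:R * chiY 3 m a = \sum_(d <- s) chiD 3 d.

(* The configuration is unordered, hence perm_eq. *)
Definition special_case (m a : int) (s : seq int) : Prop :=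
  [\/ (m, a) = (3, 4) /\ perm_eq s [:: 1; 1; 1; 1; 4; 4],
      (m, a) = (4, 3) /\ perm_eq s [:: 1; 1; 1; 1; 1; 1; 3; 3]
    | (m, a) = (6, 2) /\ perm_eq s (nseq 12 1)].

(* Main.v *)
(* In dimension 3 the coefficients of L c_2, L^2 c_1 and L^3 in the Euler
   characteristic relation amount to m a = 12, to sum a_i^2 = 12 (a - 1) and to
   sum a_i^3 = 12 (a^2 - a - 1).  So a divides 12, and the three power sums single
   out the listed solutions among the finitely many compositions of 12.
   Conversely, the relation in each case is an identity of rational functions
   of L, which holds modulo codimension > n after clearing denominators. *)

Require Import Defs.
From mathcomp Require Import all_boot all_order all_algebra.
From mathcomp Require Import mpoly ring zify.

Import Order.TTheory GRing.Theory Num.Theory.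
Local Open Scope ring_scope.

Lemma feq_dvd (n : nat) (p q r : fclass n) :
  p = q + r * 'X^(n.+1) -> feq p q.
Proof. by move=> ->; rewrite /feq take_polyD take_polyMXn_0 addr0. Qed.

Lemma LclE (n : nat) (d : int) :
  d%:~R * Lcl n = (d%:~R * 'X_ord0 : {mpoly int[n.+1]}) *: 'X.
Proof. by rewrite /Lcl !mulrzl scalerMzl. Qed.

Lemma coef0_Lcl (n : nat) (d : int) : (d%:~R * Lcl n)`_0 = 0.
Proof. by rewrite LclE coefZ coefX mulr0. Qed.

(** Keeps the truncation error as an explicit multiple of ['X^n.+1], so that congruences between
    classes become equations within reach of [ring]. *)
Lemma finv1D_mul (n : nat) (d : int) :
  exists r : fclass n, r * 'X^(n.+1) =
    (1 + d%:~R * Lcl n) * finv1D (d%:~R * Lcl n) - 1.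
Proof.
exists (drop_poly n.+1 ((1 + d%:~R * Lcl n) * finv1D (d%:~R * Lcl n))).
rewrite -{2}[_ * finv1D _](poly_take_drop n.+1) (finv1DP (coef0_Lcl n d)).
by rewrite take_poly_id ?size_poly1 // [RHS]addrAC subrr add0r.
Qed.

Lemma special_case_chern (m a : int) (s : seq int) :
  special_case m a s -> chern_relation m a s.
Proof.
case=> -[[-> ->] ps] n; rewrite (perm_big _ ps) /= !big_cons big_nil;
  rewrite /rho_cD /rho_push /cZ /c_hyp /cX;
  have [r1] := finv1D_mul n 1; have [r2] := finv1D_mul n 2;
  have [r3] := finv1D_mul n 3; have [r4] := finv1D_mul n 4;
  rewrite -[2%:R * Lcl n]/(2%:~R * Lcl n);
  move: (finv1D (1 *~ 4 * _)) (finv1D (1 *~ 3 * _)) (finv1D (1 *~ 2 * _))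
    (finv1D (1 *~ 1 * _)) => F4 F3 F2 F1;
  move: (Lcl n) (cB n) => l c e4 e3 e2 e1.
(* Multiply the left side by (1 + 2l) F2, which is 1 up to the error [r2]. The terms in [F4] then
   combine by 24(1 + 2l) - 16(1 + l) = 8(1 + 4l), and replacing (1 + 4l) F4 and (1 + l) F1 by 1
   costs the errors in [r4] and [r1]. *)
- pose k := 8 * l * F2 * c.
  apply: (@feq_dvd _ _ _ (k * r4 - k * r1 - 24 * l * F4 * c * r2)).
  by rewrite !mulrBl -!mulrA e1 e2 e4 /k; ring.
(* Likewise, with 24(1 + 2l) - 12(1 + l) = 12(1 + 3l). *)
- pose k := 12 * l * F2 * c.
  apply: (@feq_dvd _ _ _ (k * r3 - k * r1 - 24 * l * F3 * c * r2)).
  by rewrite !mulrBl -!mulrA e1 e2 e3 /k; ring.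
- apply: (@feq_dvd _ _ _ (- (24 * l * F2 * c * r1))).
  by rewrite mulNr -!mulrA e1; ring.
Qed.

Lemma coef_finv1D (n j : nat) (d : int) : (j <= n)%N ->
  (finv1D (d%:~R * Lcl n))`_j = (- (d%:~R * 'X_ord0)) ^+ j.
Proof.
move=> le_jn; rewrite /finv1D coef_sum (bigD1 (Ordinal (le_jn : (j < n.+1)%N))) //=.
have uE i : (- (d%:~R * Lcl n)) ^+ i = ((- (d%:~R * 'X_ord0)) ^+ i) *: 'X^i.
  by rewrite LclE -scaleNr exprZn.
rewrite uE coefZ coefXn eqxx mulr1 big1 ?addr0 // => i ne_ij.
move: ne_ij; rewrite uE coefZ coefXn eq_sym -val_eqE /= => /negPf ->.
by rewrite mulr0.
Qed.

Lemma coef_cB (n : nat) (i : 'I_n.+1) :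
  (cB n)`_i = if i == ord0 then 1 else 'X_i.
Proof.
rewrite /cB coefD coef1 coef_sum.
under eq_bigr => j _ do rewrite coefZ coefXn.
have [->|i0] := eqVneq i ord0.
  rewrite big1 ?addr0 //= => j j0.
  by rewrite ltn_eqF //= mulr0.
have i_gt0 : (0 < i)%N by rewrite lt0n.
rewrite (bigD1 i) //= eqxx mulr1 big1 ?addr0 => [|j /andP[_ ne_ji]].
  by rewrite gtn_eqF // add0r.
by rewrite val_eqE eq_sym (negPf ne_ji) /= mulr0.
Qed.

Lemma coef3_c_hyp (d : int) (p : fclass 3) (x := d%:~R * 'X_ord0) :
  (c_hyp d p)`_3 = x * p`_2 - x ^+ 2 * p`_1 + x ^+ 3 * p`_0.
Proof.
rewrite /c_hyp -mulrA LclE -/x -scalerAl coefZ coefXM /= coefM.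
by rewrite !big_ord_recl big_ord0 /= -LclE !coef_finv1D //= -/x; ring.
Qed.

Lemma coef_cX (y := 'X_ord0 : {mpoly int[4]}) :
  [/\ (cX 3)`_0 = 1, (cX 3)`_1 = 'X_1 - y
    & (cX 3)`_2 = 'X_2 - y * 'X_1 + 2 * y ^+ 2].
Proof.
have LF i : (i < 3)%N -> ((1 + Lcl 3) * finv1D (2%:R * Lcl 3))`_i =
    (- (2 * y)) ^+ i + (if i is j.+1 then y * (- (2 * y)) ^+ j else 0).
  move=> lt_i3; rewrite -[2%:R * _]/(2%:~R * Lcl 3) mulrDl mul1r coefD.
  rewrite coef_finv1D 1?ltnW //; congr (_ + _).
  rewrite /Lcl -scalerAl coefZ coefXM; case: i lt_i3 => [|i] lt_i3 /=.
    by rewrite mulr0.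
  by rewrite -/(Lcl 3) coef_finv1D // ltnW // ltnW.
have c0 := coef_cB 3 ord0.
have c1 := coef_cB 3 1.
have c2 := coef_cB 3 2.
rewrite /= in c0 c1 c2.
by split; rewrite /cX coefM !big_ord_recl big_ord0 /= !LF //= ?c0 ?c1 ?c2; ring.
Qed.

(** Evaluating L, c_1, c_2 at integers turns the polynomial identity into integer equations. The
    factor L in the class of a hypersurface keeps c_3 out. *)
Lemma meval_chiY (m a : int) (v : 'I_4 -> int) (x := v 0) :
  (chiY 3 m a).@[v] =
    m * (a * x * v 2 - a ^+ 2 * x ^+ 2 * v 1 + a ^+ 3 * x ^+ 3).
Proof.
rewrite /chiY /fdeg mulrzl coefMrz /cZ coef3_c_hyp.
rewrite (coef_cB 3 ord0) (coef_cB 3 1) (coef_cB 3 2) /=.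
by rewrite -mulrzl !(rmorphM, rmorphD, rmorphN, rmorphXn, rmorph1, rmorph_int) /=
  !mevalXU !intz /x; ring.
Qed.

Lemma meval_chiD (d : int) (v : 'I_4 -> int) (x := v 0) :
  (chiD 3 d).@[v] = 2 * (d * (x * v 2 - x ^+ 2 * v 1 + 2 * x ^+ 3)
    - d ^+ 2 * (x ^+ 2 * v 1 - x ^+ 3) + d ^+ 3 * x ^+ 3).
Proof.
rewrite /chiD /fdeg /rho_cD /rho_push mulr_natl coefMn coef3_c_hyp.
have [-> -> ->] := coef_cX; rewrite -mulr_natl.
by rewrite !(rmorphM, rmorphD, rmorphN, rmorphXn, rmorph1, rmorph_int, rmorph_nat) /=
  !mevalXU !intz /x; ring.
Qed.

Lemma euler_relation_coef (m a : int) (s : seq int) :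
  \sum_(d <- s) d = 12 -> euler_relation m a s ->
  [/\ m * a = 12, \sum_(d <- s) d ^+ 2 = 12 * a - 12
    & \sum_(d <- s) d ^+ 3 = 12 * a ^+ 2 - 12 * a - 12].
Proof.
move=> s1 rel.
set s2 := \sum_(d <- s) d ^+ 2; set s3 := \sum_(d <- s) d ^+ 3.
have ev (v : 'I_4 -> int) (x := v 0) :
    m * (a * x * v 2 - a ^+ 2 * x ^+ 2 * v 1 + a ^+ 3 * x ^+ 3) =
    12 * (x * v 2 - x ^+ 2 * v 1 + 2 * x ^+ 3)
      - s2 * (x ^+ 2 * v 1 - x ^+ 3) + s3 * x ^+ 3.
  have := congr1 (meval v) rel.
  rewrite rmorphM rmorph_nat rmorph_sum /= meval_chiY.
  under eq_bigr => d _ do rewrite meval_chiD.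
  rewrite -mulr_sumr big_split sumrB /= -!mulr_suml s1 -/s2 -/s3 -/x.
  by lia.
(* The digits in [e100], [e101], [e110] are the values of L, c_1, c_2. Subtracting [e100] from
   [e101] isolates m a, subtracting [e110] from [e100] isolates m a^2, and [e100] then yields
   [s3]. *)
have := ev (fun i => (i == 0)%:R).
have := ev (fun i => (i != 1)%:R).
have := ev (fun i => (i != 2)%:R).
rewrite /= !(mulr0, mulr1, expr1n, subr0, sub0r, add0r) => e110 e101 e100.
have ma : m * a = 12 by lia.
have ma2 : m * a ^+ 2 = 12 * a by rewrite -ma; ring.
have ma3 : m * a ^+ 3 = 12 * a ^+ 2 by rewrite -ma; ring.
by split; lia.
Qed.

(** Ordered lists avoid any sorting of the a_i. The default head 0 makes both branches yield
    [[:: 1]] at n = 1, a harmless repetition. *)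
Fixpoint compositions (n : nat) : seq (seq nat) :=
  if n is k.+1 then
    [seq 1%N :: t | t <- compositions k] ++
    [seq (head 0%N t).+1 :: behead t | t <- compositions k]
  else [:: [::]].

(** Induction on the sum: a first entry 1 is removed, a larger one is lowered by 1 and stays
    positive. *)
Lemma mem_compositions (t : seq nat) :
  0%N \notin t -> t \in compositions (sumn t).
Proof.
move: {-2}(sumn t) (erefl (sumn t)) => n.
elim: n t => [|n IHn] [|[|[|x]] t] //=; rewrite mem_cat => t_n t0.
  apply/orP; left; rewrite mem_map => [|u v []//].
  by apply: IHn => //; case: t_n.
apply/orP; right; apply/mapP; exists (x.+1 :: t) => //.
by apply: IHn => //=; case: t_n.
Qed.

(** A finite check of 4096 lists against the six divisors of 12. Negative terms are moved across,
    since subtraction on [nat] truncates. *)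
Lemma compositions12_power_sums :
  all (fun t => all (fun a =>
    [&& sumn [seq d ^ 2 | d <- t] + 12 == 12 * a
      & sumn [seq d ^ 3 | d <- t] + 12 * a + 12 == 12 * a ^ 2]%N ==>
    [|| (a == 4) && perm_eq t [:: 1; 1; 1; 1; 4; 4],
        (a == 3) && perm_eq t [:: 1; 1; 1; 1; 1; 1; 3; 3]
      | (a == 2) && perm_eq t (nseq 12 1)]%N) (divisors 12)) (compositions 12).
Proof. by vm_compute. Qed.

Lemma euler_relation_special (m a : int) (s : seq int) :
  (forall d : int, d \in s -> 0 < d) -> \sum_(d <- s) d = 12 ->
  euler_relation m a s -> special_case m a s.
Proof.
move=> s_gt0 s1 /(euler_relation_coef _ _ _ s1) [ma s2 s3].
have [t def_s t0] : exists2 t : seq nat, s = [seq Posz d | d <- t] & 0%N \notin t.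
  exists [seq `|d|%N | d <- s].
    rewrite -map_comp -[LHS]map_id; apply/eq_in_map => d /s_gt0 /= d_gt0.
    by rewrite gez0_abs ?ltW.
  by apply/mapP => -[d /s_gt0 d_gt0 /esym/eqP]; rewrite absz_eq0 gt_eqF.
have sumE k : \sum_(d <- s) d ^+ k = (sumn [seq d ^ k | d <- t]%N)%:Z.
  rewrite def_s big_map sumnE big_map -natz natr_sum.
  by apply: eq_bigr => d _; rewrite natrX natz.
have t1 : sumn t = 12.
  have := sumE 1%N; under eq_bigr => d _ do rewrite expr1.
  by rewrite s1 map_id => -[].
(* 12 (a - 1) is a sum of squares, which forces a > 0, and then m > 0 by m a = 12. *)
have s2_ge0 : 0 <= \sum_(d <- s) d ^+ 2 by rewrite sumE.
rewrite sumE in s2; rewrite sumE in s3.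
have a_gt0 : 0 < a by lia.
case: a a_gt0 => // a a_gt0 in ma s2 s3 s2_ge0 *.
have m_gt0 : 0 < m by rewrite -(pmulr_lgt0 m a_gt0) ma.
case: m m_gt0 => // m m_gt0 in ma *.
have a12 : a \in divisors 12 by rewrite -dvdn_divisors //; apply/dvdnP; exists m; lia.
have tP := mem_compositions _ t0; rewrite t1 in tP.
have /implyP := allP (allP compositions12_power_sums t tP) a a12.
have -> : [&& sumn [seq d ^ 2 | d <- t] + 12 == 12 * a
      & sumn [seq d ^ 3 | d <- t] + 12 * a + 12 == 12 * a ^ 2]%N.
  by apply/andP; split; apply/eqP; lia.
case/(_ isT)/or3P => /andP[/eqP def_a /(perm_map Posz) pt];
  rewrite -def_s /= in pt; [constructor 1 | constructor 2 | constructor 3];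
  split=> //; subst a; congr (_, _); lia.
Qed.

Theorem theorem4p9 (m a : int) (s : seq int)
    (s_gt0 : forall d : int, d \in s -> 0 < d)
    (s_sum : \sum_(d <- s) d = 12) :
  [/\ chern_relation m a s <-> special_case m a s,
      take 4 s = nseq 4 1 -> euler_relation_4O m a s -> special_case m a s
    & euler_relation m a s -> special_case m a s].
Proof.
have special := euler_relation_special m a s s_gt0 s_sum.
split=> //.
  split=> [rel|]; last exact: special_case_chern.
  (* The codimension 3 part of the relation for n = 3 is the Euler characteristic relation. *)
  apply: special; have /(congr1 (fun p : fclass 3 => p`_3)) := rel 3%N.
  rewrite !coef_take_poly /= coef_sum => eq3.
  rewrite /euler_relation /chiY /fdeg mulr_natl -coefMn -mulr_natl mulrA.
  exact: eq3.
move=> s4 rel; apply: special; rewrite /euler_relation rel.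
rewrite -[s in RHS](cat_take_drop 4) s4 big_cat /= !big_cons big_nil /chiO.
by ring.
Qed.
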